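(* Let $(\mathbf X_1,\mathbf Y_1)$ and $(\mathbf X_2,\mathbf Y_2)$ be general correlated sources, both uniformly integrable, and let $(\mathbf X,\mathbf Y)$ be their mixture $P_{X^nY^n}=\alpha_1P_{X_1^nY_1^n}+\alpha_2P_{X_2^nY_2^n}$ with constants $\alpha_1,\alpha_2>0$, $\alpha_1+\alpha_2=1$. Then \[\overline H_s(\mathbf X|\mathbf Y)\ge\lim_{\varepsilon\downarrow0}\limsup_{n\to\infty}\sum_{i=1,2}\frac{\alpha_i}{n}\overline H_s^\varepsilon(X_i^n|Y_i^n).\]
   Context: A general correlated source $\{(X^n,Y^n)\}_{n\ge1}$ is an arbitrary sequence of pairs of random variables on $\mathcal X^n\times\mathcal Y^n$, $\mathcal X,\mathcal Y$ finite or countably infinite (no structural assumptions; marginal probabilities positive). Logs base 2. A source is uniformly integrable if $Z_n=\frac1n\log\frac1{P_{X^n|Y^n}(X^n|Y^n)}$ satisfies $\lim_{u\to\infty}\sup_n\sum_{z:|z|\ge u}P_{Z_n}(z)|z|=0$. For a source with distributions $P_{X^nY^n}$, $x^n\in\mathcal X^n$ and $\varepsilon\in(0,1]$: $\overline h^\varepsilon(x^n|P_{X^nY^n})=\inf\{a\in\mathbb R:\sum_{y^n:\log(1/P_{X^n|Y^n}(x^n|y^n))>a}P_{Y^n|X^n}(y^n|x^n)\le\varepsilon\}$; $\overline H_s^\varepsilon(X^n|Y^n)=\sum_{x^n}P_{X^n}(x^n)\overline h^\varepsilon(x^n|P_{X^nY^n})$ (and analogously $\overline H_s^\varepsilon(X_i^n|Y_i^n)$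 using $P_{X_i^nY_i^n}$); $\overline H_s(\mathbf X|\mathbf Y)=\lim_{\varepsilon\downarrow0}\limsup_n\frac1n\overline H_s^\varepsilon(X^n|Y^n)$. *)

(* Defs.v *)
From HB Require Import structures.
From mathcomp Require Import all_boot all_order all_algebra.
From mathcomp Require Import all_classical all_reals all_analysis.
Set Implicit Arguments. Unset Strict Implicit. Unset Printing Implicit Defensive.
Import Order.TTheory GRing.Theory Num.Theory.
Import numFieldNormedType.Exports.
Local Open Scope classical_set_scope.
Local Open Scope ring_scope.

Section Defs.
Variable R : realType.
Variables X Y : countType.

Definition log2 (x : R) : R := ln x / ln 2.

(* A general correlated source: for each n, the joint pmf of (X^n, Y^n). *)
Definition source := forall n : nat, n.-tuple X * n.-tuple Y -> R.

Definition margX (P : source) n (x : n.-tuple X) : R :=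
  fine (\esum_(y in [set: n.-tuple Y]) (P n (x, y))%:E).
Definition margY (P : source) n (y : n.-tuple Y) : R :=
  fine (\esum_(x in [set: n.-tuple X]) (P n (x, y))%:E).

Definition condXY (P : source) n (x : n.-tuple X) (y : n.-tuple Y) : R :=
  P n (x, y) / margY P y.
Definition condYX (P : source) n (y : n.-tuple Y) (x : n.-tuple X) : R :=
  P n (x, y) / margX P x.

Definition is_source (P : source) : Prop :=
  forall n, (0 < n)%N ->
    [/\ (forall z, 0 <= P n z),
        \esum_(z in [set: n.-tuple X * n.-tuple Y]) (P n z)%:E = 1%E,
        (forall x : n.-tuple X, 0 < margX P x) &
        (forall y : n.-tuple Y, 0 < margY P y)].

Definition Zfun (P : source) n (xy : n.-tuple X * n.-tuple Y) : R :=
  n%:R^-1 * log2 (1 / condXY P xy.1 xy.2).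

Definition PZ (P : source) n (z : R) : \bar R :=
  \esum_(xy in [set xy | Zfun P xy = z]) (P n xy)%:E.

Definition unif_integrable (P : source) : Prop :=
  (fun u : R => ereal_sup [set
     (\esum_(z in [set z : R | (u <= `|z|)%R]) (PZ P n z * (`|z|)%:E))%E
     | n in [set n : nat | (0 < n)%N]]) @ +oo --> 0%E.

Definition hbar (P : source) (eps : R) n (x : n.-tuple X) : \bar R :=
  ereal_inf [set a%:E | a in [set a : R |
    (\esum_(y in [set y | (log2 (1 / condXY P x y) > a)%R]) (condYX P y x)%:E
       <= eps%:E)%E]].

Definition Hs_eps (P : source) (eps : R) n : \bar R :=
  \esum_(x in [set: n.-tuple X]) ((margX P x)%:E * hbar P eps x)%E.

Definition Hs (P : source) : \bar R :=
  lim ((fun eps : R =>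
          limn_esup (fun n => ((n%:R^-1)%:E * Hs_eps P eps n)%E)) @ 0^'+).

Definition mixture (a1 a2 : R) (P1 P2 : source) : source :=
  fun n z => a1 * P1 n z + a2 * P2 n z.

End Defs.

(* Main.v *)
(** Each component [Q] of the mixture [P] satisfies [c * Q <= P].  Given [x], let
[h] be the [eps]-quantile of the information density of [P] under [P(.|x)].
Under [Q(.|x)], domination shows that the information density of [Q] exceeds
[h + log2 (1 / eps)] with probability at most [2 * eps * P(x) / (c * Q(x))]: either
the density of [P] exceeds [h], or [Q(x,y)] is at most [eps * P(x,y) / c].  If
this bound is at most [eps'], then [hbar Q eps' x <= h + log2 (1 / eps)].  Otherwise [Q(x)] is
at most [2 * eps * P(x) / (eps' * c)], and Markov's inequality bounds
[Q(x) * hbar Q eps' x] by [Q(x) * t] plus a truncated mean of the information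
density.  Summing over [x] with [t = n * u], uniform integrability absorbs the
truncated mean once [u] is large; then [eps] is taken small and [n] large. *)

Require Import Defs.
From HB Require Import structures.
From mathcomp Require Import all_boot all_order all_algebra.
From mathcomp Require Import all_classical all_reals all_analysis.
From mathcomp Require Import ring lra.
Import Order.TTheory GRing.Theory Num.Theory.
Import numFieldNormedType.Exports.
Local Open Scope classical_set_scope.
Local Open Scope ring_scope.

(** * Nonnegative extended sums: scaling, restriction, product sets and fibres *)

Section NonnegativeSums.
Context {R : realType} {T : choiceType}.
Implicit Types (A B : set T) (a : T -> \bar R).
Local Open Scope ereal_scope.

Lemma esumZl A a (c : R) : (0 <= c)%R -> (forall i, 0 <= a i) ->
  \esum_(i in A) (c%:E * a i) = c%:E * \esum_(i in A) a i.
Proof.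
move=> c0 a0; rewrite /esum -ereal_supZl//; last first.
  by apply/set0P; eexists; exists set0; [exact: fsets_set0|].
congr ereal_sup; rewrite image_comp; apply: eq_imagel => F [finF _] /=.
by rewrite ge0_mule_fsumr.
Qed.

Lemma le_esum_subset A B a : A `<=` B -> (forall i, 0 <= a i) ->
  \esum_(i in A) a i <= \esum_(i in B) a i.
Proof.
move=> AB a0; rewrite esum_mkcond [leRHS]esum_mkcond; apply: le_esum => i _.
case: ifPn => [/set_mem /AB /mem_set ->//|_].
by case: ifP.
Qed.

End NonnegativeSums.

Lemma esum_prod {R : realType} {T1 T2 : choiceType} (a : T1 -> T2 -> \bar R)
    (D : set (T1 * T2)) : (forall i j, 0 <= a i j)%E ->
  \esum_(i in [set: T1]) \esum_(j in [set j | D (i, j)]) a i j =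
  \esum_(k in D) a k.1 k.2.
Proof.
move=> a0; rewrite esum_esum//; congr esum.
by apply/seteqP; split => -[i j] //= [].
Qed.

(** Each [i] lies in exactly one fibre, so [i |-> (f i, i)] reindexes the sum. This turns a sum
    against the law of [Zfun] into a sum over pairs. *)
Lemma esum_fibers {R : realType} {T1 T2 : choiceType} (f : T1 -> T2)
    (D : set T2) (a : T1 -> \bar R) : (forall i, 0 <= a i)%E ->
  \esum_(j in D) \esum_(i in [set i | f i = j]) a i =
  \esum_(i in f @^-1` D) a i.
Proof.
move=> a0; rewrite esum_esum//.
rewrite (@reindex_esum _ _ _ (f @^-1` D) _ (fun i => (f i, i)))//; split.
- by move=> i /= Di; split.
- by move=> i i' _ _ [].
- by move=> [j i] /= [Dj fij]; exists i; [rewrite /preimage /= fij|rewrite fij].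
Qed.

(** * A single source: marginals, information density and its quantile [hbar] *)

Section SourceFacts.
Context {R : realType} {X Y : countType}.
Implicit Type P : source R X Y.

Lemma log2_le0 (x : R) : x <= 1 -> log2 x <= 0.
Proof. by move=> x1; rewrite mulr_le0_ge0 ?ln_le0// invr_ge0 ln_ge0// ler1n. Qed.

Lemma ln2_gt0 : 0 < ln 2 :> R.
Proof. by rewrite ln_gt0// ltr1n. Qed.

Lemma log2V (x : R) : 0 < x -> log2 (1 / x) = - log2 x.
Proof. by move=> x0; rewrite /log2 div1r lnV ?posrE// mulNr. Qed.

Lemma ltr_log2 : {in Num.pos &, {mono @log2 R : x y / x < y}}.
Proof. by move=> x y x0 y0; rewrite ltr_pM2r ?invr_gt0 ?ln2_gt0// ltr_ln. Qed.

Lemma log2M : {in Num.pos &, {morph @log2 R : x y / x * y >-> x + y}}.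
Proof. by move=> x y x0 y0; rewrite /log2 lnM// mulrDl. Qed.

Section FixedLength.
Context {P : source R X Y} {n : nat}.
Hypotheses (srcP : is_source P) (n_gt0 : (0 < n)%N).

Lemma source_ge0 z : 0 <= P n z.
Proof. by have [] := srcP n n_gt0. Qed.

Let P_ge0E z : (0 <= (P n z)%:E)%E.
Proof. by rewrite lee_fin source_ge0. Qed.

Lemma margX_gt0 x : 0 < @margX _ _ _ P n x.
Proof. by have [] := srcP n n_gt0. Qed.

Lemma margY_gt0 y : 0 < @margY _ _ _ P n y.
Proof. by have [] := srcP n n_gt0. Qed.

Lemma esum_source : \esum_(z in [set: n.-tuple X * n.-tuple Y]) (P n z)%:E = 1%E.
Proof. by have [] := srcP n n_gt0. Qed.

Lemma esum_source_le1 (T : choiceType) (D : set T) (f : T -> _) :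
  set_inj D f -> (\esum_(t in D) (P n (f t))%:E <= 1)%E.
Proof.
move=> injf; rewrite -(esum_image D f (fun z => (P n z)%:E) injf).
rewrite -esum_source; exact: le_esum_subset.
Qed.

(** The sum is at most the total mass 1, so [fine] loses nothing. *)
Lemma margXE x : (margX P x)%:E = \esum_(y in [set: n.-tuple Y]) (P n (x, y))%:E.
Proof.
rewrite fineK// ge0_fin_numE ?esum_ge0//.
by rewrite (le_lt_trans (@esum_source_le1 _ setT (pair x) _)) ?ltry// => y y' _ _ [].
Qed.

Lemma margYE y : (margY P y)%:E = \esum_(x in [set: n.-tuple X]) (P n (x, y))%:E.
Proof.
rewrite fineK// ge0_fin_numE ?esum_ge0//.
by rewrite (le_lt_trans (@esum_source_le1 _ setT (pair^~ y) _)) ?ltry// => x x' _ _ [].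
Qed.

Lemma source_le_margY x y : P n (x, y) <= margY P y.
Proof.
rewrite -lee_fin margYE -(@esum_set1 _ _ x (fun x => (P n (x, y))%:E))//.
exact: le_esum_subset.
Qed.

Lemma esum_margX : \esum_(x in [set: n.-tuple X]) (margX P x)%:E = 1%E.
Proof.
rewrite -esum_source (eq_esum (fun x _ => margXE x)).
apply: etrans (esum_prod (fun x y => (P n (x, y))%:E) setT _) _ => //.
by apply: eq_esum => -[].
Qed.

Lemma information_ge0 x y : 0 <= log2 (1 / @condXY _ _ _ P n x y).
Proof.
(* At a null pair [1 / 0] and [ln 0] are both 0, so the density is 0 there rather than infinite.
   Elsewhere the conditional probability is at most 1. *)
have [P0|P0] := eqVneq (P n (x, y)) 0.
  by rewrite /condXY P0 mul0r invr0 mulr0 /log2 ln0// mul0r.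
have c0 : 0 < condXY P x y by rewrite divr_gt0 ?margY_gt0// lt0r P0 source_ge0.
rewrite log2V// oppr_ge0 log2_le0// ler_pdivrMr ?margY_gt0// mul1r.
exact: source_le_margY.
Qed.

(** Multiplying by [margX P x > 0] clears the conditional, so that tails of two sources can be
    compared through joint masses. *)
Lemma information_tail_leE (x : n.-tuple X) (eps a : R) :
  (\esum_(y in [set y | (log2 (1 / condXY P x y) > a)%R]) (condYX P y x)%:E
     <= eps%:E)%E =
  (\esum_(y in [set y | (log2 (1 / condXY P x y) > a)%R]) (P n (x, y))%:E
     <= (eps * margX P x)%:E)%E.
Proof.
under eq_esum do rewrite /condYX mulrC EFinM.
rewrite esumZl ?invr_ge0 ?(ltW (margX_gt0 _))//.
by rewrite lee_pdivrMl ?margX_gt0// mulrC.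
Qed.

Lemma hbar_le (x : n.-tuple X) (eps a : R) :
  (\esum_(y in [set y | (log2 (1 / condXY P x y) > a)%R]) (P n (x, y))%:E
     <= (eps * margX P x)%:E)%E -> (hbar P eps x <= a%:E)%E.
Proof.
move=> H; apply: ge_ereal_inf; exists a%:E => //.
by exists a => //=; rewrite information_tail_leE.
Qed.

Lemma hbar_ge (x : n.-tuple X) (eps : R) (b : \bar R) :
  (forall a, \esum_(y in [set y | (log2 (1 / condXY P x y) > a)%R]) (P n (x, y))%:E
     <= (eps * margX P x)%:E -> b <= a%:E)%E -> (b <= hbar P eps x)%E.
Proof.
move=> H; apply/ereal_infP => _ [a /= Ha <-]; apply: H.
by rewrite -information_tail_leE.
Qed.

(** For [a < 0] the tail set is everything, and its conditional mass 1 exceeds [eps]. *)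
Lemma hbar_ge0 (x : n.-tuple X) (eps : R) : eps < 1 -> (0 <= hbar P eps x)%E.
Proof.
move=> eps1; apply: hbar_ge => a; rewrite [(0 <= a%:E)%E]lee_fin.
case: (leP 0 a) => // a0.
rewrite [X in esum X](_ : _ = setT); last first.
  by apply/seteqP; split => // y _ /=; rewrite (lt_le_trans a0) ?information_ge0.
by rewrite -margXE lee_fin leNgt gtr_pMl ?margX_gt0// eps1.
Qed.

Lemma le_hbar (x : n.-tuple X) (eps eps' : R) :
  eps <= eps' -> (hbar P eps' x <= hbar P eps x)%E.
Proof.
move=> le_eps; apply: hbar_ge => a Ha; apply: hbar_le; apply: le_trans Ha _.
by rewrite lee_fin ler_wpM2r// ltW// margX_gt0.
Qed.

Lemma le_Hs_eps (eps eps' : R) :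
  eps <= eps' -> (Hs_eps P eps' n <= Hs_eps P eps n)%E.
Proof.
move=> le_eps; apply: le_esum => x _; apply: lee_wpmul2l; last exact: le_hbar.
by rewrite lee_fin ltW// margX_gt0.
Qed.

End FixedLength.
End SourceFacts.

(** * Transfer of quantile bounds from a dominating source [P] to [Q] *)

Section Domination.
Context {R : realType} {X Y : countType}.
Context {P Q : source R X Y} {n : nat} {c : R}.
Hypotheses (srcP : is_source P) (srcQ : is_source Q) (n_gt0 : (0 < n)%N).
Hypotheses (c_gt0 : 0 < c) (QP : forall z, c * Q n z <= P n z).

Let P_ge0 z : 0 <= P n z := source_ge0 srcP n_gt0 z.
Let Q_ge0 z : 0 <= Q n z := source_ge0 srcQ n_gt0 z.
Let P_ge0E z : (0 <= (P n z)%:E)%E.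
Proof. by rewrite lee_fin. Qed.
Let Q_ge0E z : (0 <= (Q n z)%:E)%E.
Proof. by rewrite lee_fin. Qed.

Lemma margY_dominated (y : n.-tuple Y) : c * margY Q y <= margY P y.
Proof.
rewrite -lee_fin EFinM (margYE srcP)// (margYE srcQ)// -esumZl ?(ltW c_gt0)//.
by apply: le_esum => x _; rewrite -EFinM lee_fin.
Qed.

(** The two logarithmic bounds give [condXY Q x y < e * condXY P x y]. Clearing denominators leaves
    the factor [c * margY Q y / margY P y], which is at most 1. *)
Lemma likelihood_ratio_le (x : n.-tuple X) (y : n.-tuple Y) (a e : R) :
  0 < e -> log2 (1 / condXY P x y) <= a ->
  a - log2 e < log2 (1 / condXY Q x y) -> c * Q n (x, y) <= e * P n (x, y).
Proof.
move=> e0 LPa aLQ; have [Q0|Q0] := eqVneq (Q n (x, y)) 0.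
  by rewrite Q0 mulr0 mulr_ge0// ltW.
have Qgt0 : 0 < Q n (x, y) by rewrite lt0r Q0 Q_ge0.
have Pgt0 : 0 < P n (x, y) by rewrite (lt_le_trans _ (QP _))// mulr_gt0.
have mP := margY_gt0 srcP n_gt0 y; have mQ := margY_gt0 srcQ n_gt0 y.
have cQ : 0 < condXY Q x y by rewrite divr_gt0.
have cP : 0 < condXY P x y by rewrite divr_gt0.
have : condXY Q x y < e * condXY P x y.
  have ecP := mulr_gt0 e0 cP.
  rewrite -ltr_log2 ?posrE// log2M ?posrE//.
  by move: LPa aLQ; rewrite !log2V//; lra.
rewrite /condXY ltr_pdivrMr// => /ltW Hle.
have : c * Q n (x, y) <= e * P n (x, y) * ((c * margY Q y) / margY P y).
  apply: le_trans (ler_wpM2l (ltW c_gt0) Hle) _.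
  by rewrite le_eqVlt; apply/orP; left; apply/eqP; field; rewrite gt_eqF.
move/le_trans; apply; rewrite ler_piMr ?mulr_ge0 ?(ltW e0)//.
by rewrite ler_pdivrMr// mul1r margY_dominated.
Qed.

Lemma information_tail_dominated (x : n.-tuple X) (a e : R) : 0 < e ->
  (\esum_(y in [set y | (log2 (1 / condXY P x y) > a)%R]) (P n (x, y))%:E
     <= (e * margX P x)%:E)%E ->
  (\esum_(y in [set y | (log2 (1 / condXY Q x y) > a - log2 e)%R]) (Q n (x, y))%:E
     <= (2 * e * margX P x / c)%:E)%E.
Proof.
move=> e0 Ha.
(* A majorant of [Q] on its tail: the first term serves where the density of [P] exceeds [a], the
   second where [likelihood_ratio_le] applies. Each sums to at most [e * margX P x / c]. *)
pose b y := (c^-1%:E * (if y \in [set y | (log2 (1 / condXY P x y) > a)%R]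
   then (P n (x, y))%:E else 0) + (c^-1 * e)%:E * (P n (x, y))%:E)%E.
have ci : 0 <= c^-1 by rewrite invr_ge0 ltW.
have ind0 y : (0 <= if y \in [set y | (log2 (1 / condXY P x y) > a)%R]
   then (P n (x, y))%:E else 0)%E by case: ifP.
have b0 y : (0 <= b y)%E.
  by rewrite adde_ge0// mule_ge0// lee_fin// mulr_ge0// ltW.
apply: (@le_trans _ _ (\esum_(y in [set: n.-tuple Y]) b y)).
  apply: le_trans (le_esum_subset _ _ _ (@subsetT _ _) b0).
  apply: le_esum => y /= LQ; rewrite /b; case: ifPn => [_|].
    rewrite -!EFinM -EFinD lee_fin.
    apply: (@le_trans _ _ (c^-1 * P n (x, y))).
      by rewrite ler_pdivlMl.
    by rewrite lerDl !mulr_ge0// ltW.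
  move=> /negP La; have {}La : log2 (1 / condXY P x y) <= a.
    by rewrite leNgt; apply/negP => h; apply: La; rewrite inE.
  rewrite mule0 add0e -EFinM lee_fin -mulrA ler_pdivlMl//.
  exact: likelihood_ratio_le LQ.
rewrite /b esumD; last 2 first.
- by move=> y _; rewrite mule_ge0.
- by move=> y _; rewrite mule_ge0// lee_fin mulr_ge0// ltW.
rewrite !esumZl// ?mulr_ge0// ?(ltW e0)// -esum_mkcond -(margXE srcP)//.
have -> : (2 * e * margX P x / c)%:E =
  (c^-1%:E * (e * margX P x)%:E + (c^-1 * e)%:E * (margX P x)%:E)%E.
  by rewrite -!EFinM -EFinD; congr EFin; ring.
by rewrite leeD2r// lee_wpmul2l.
Qed.

(* Markov's inequality for the information density truncated to [t, +oo). *)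
Lemma hbar_le_truncation (x : n.-tuple X) (t e : R) : 0 < t -> 0 < e ->
  ((margX Q x)%:E * hbar Q e x <= (margX Q x * t)%:E + e^-1%:E *
   \esum_(y in [set y | (t <= log2 (1 / condXY Q x y))%R])
      (Q n (x, y) * log2 (1 / condXY Q x y))%:E)%E.
Proof.
move=> t0 e0.
set T := \esum_(y in _) _.
have q0 := margX_gt0 srcQ n_gt0 x.
have f0 y : (0 <= (Q n (x, y) * log2 (1 / condXY Q x y))%:E)%E.
  by rewrite lee_fin mulr_ge0// information_ge0.
have T0 : (0 <= T)%E by exact: esum_ge0.
have [Toy|] := eqVneq T +oo%E.
  by rewrite Toy gt0_muley ?lte_fin ?invr_gt0// addey// leey.
rewrite -ltey -ge0_fin_numE// => /fineK ET.
(* Chosen so that [margX Q x * a] is exactly the claimed bound; Markov's inequality at level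
   [a >= t] then leaves a tail of mass at most [e * margX Q x]. *)
pose a := t + fine T / (e * margX Q x).
have fT : 0 <= fine T by rewrite fine_ge0.
have a0 : 0 < a by rewrite ltr_wpDr// divr_ge0// ltW// mulr_gt0.
have : (hbar Q e x <= a%:E)%E.
  apply: hbar_le => //.
  set S := \esum_(y in _) _.
  have aST : (a%:E * S <= T)%E.
    rewrite -esumZl// ?(ltW a0)//.
    apply: le_trans (le_esum_subset
      [set y | (log2 (1 / condXY Q x y) > a)%R] _ _ _ f0).
      apply: le_esum => y /= /ltW ya; rewrite -EFinM lee_fin mulrC.
      exact: ler_wpM2l.
    move=> y /= /ltW; apply: le_trans.
    by rewrite lerDl divr_ge0// ltW// mulr_gt0.
  rewrite -(lee_pmul2l (x := a%:E)) ?lte_fin//.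
  apply: le_trans aST _; rewrite -ET -EFinM lee_fin.
  have -> : fine T = (a - t) * (e * margX Q x).
    by rewrite /a; field; rewrite !gt_eqF.
  by rewrite ler_wpM2r ?mulr_ge0 ?ltW// gtrBl.
move=> /(lee_wpmul2l (x := (margX Q x)%:E)); rewrite lee_fin => /(_ (ltW q0)).
move/le_trans; apply; rewrite -ET -!EFinM -EFinD lee_fin.
by rewrite le_eqVlt; apply/orP; left; apply/eqP; rewrite /a; field; rewrite !gt_eqF.
Qed.

(** Every error term is nonnegative, so one bound covers both cases and can be summed over all [x]
    without splitting them. *)
Lemma hbar_dominated (x : n.-tuple X) (t e e' : R) :
  0 < t -> 0 < e < 1 -> 0 < e' ->
  ((margX Q x)%:E * hbar Q e' x <=
   (margX Q x)%:E * hbar P e x + (- log2 e)%:E * (margX Q x)%:E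
   + (2 * e * t / (e' * c))%:E * (margX P x)%:E
   + e'^-1%:E * \esum_(y in [set y | (t <= log2 (1 / condXY Q x y))%R])
      (Q n (x, y) * log2 (1 / condXY Q x y))%:E)%E.
Proof.
move=> t0 /andP[e0 e1] e'0.
have q0 := margX_gt0 srcQ n_gt0 x; have p0 := margX_gt0 srcP n_gt0 x.
have l0 : 0 <= - log2 e by rewrite oppr_ge0 log2_le0// ltW.
set T := \esum_(y in _) _.
have T0 : (0 <= e'^-1%:E * T)%E.
  rewrite mule_ge0 ?lee_fin ?invr_ge0 ?(ltW e'0)// esum_ge0// => y _.
  by rewrite lee_fin mulr_ge0// information_ge0.
have h0 : (0 <= (margX Q x)%:E * hbar P e x)%E.
  by rewrite mule_ge0 ?lee_fin ?(ltW q0)// hbar_ge0.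
(* In the good case each level admissible for [P], shifted by [- log2 e], is admissible for [Q] at
   [e']. In the bad case the smallness of [margX Q x] pays for [margX Q x * t]. *)
have [good|bad] := leP (2 * e * margX P x / c) (e' * margX Q x).
  have hQP : (hbar Q e' x <= hbar P e x + (- log2 e)%:E)%E.
    rewrite -leeBlDr//; apply: hbar_ge => // a Ha.
    rewrite leeBlDr// -EFinD; apply: hbar_le => //.
    apply: le_trans (information_tail_dominated _ _ _ e0 Ha) _.
    by rewrite lee_fin.
  rewrite -addeA lee_paddr//.
    by rewrite adde_ge0// mule_ge0// lee_fin ?(ltW p0)// divr_ge0 ?mulr_ge0 ?ltW.
  rewrite (muleC (- log2 e)%:E) -ge0_muleDr// ?lee_fin//; last exact: hbar_ge0.
  by rewrite lee_wpmul2l// lee_fin ltW.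
apply: le_trans (hbar_le_truncation x t e' t0 e'0) _; rewrite leeD2r//.
rewrite lee_paddl//.
  by rewrite adde_ge0// mule_ge0 ?lee_fin ?(ltW q0).
rewrite -EFinM lee_fin.
have -> : 2 * e * t / (e' * c) * margX P x = t * ((2 * e * margX P x / c) / e').
  by field; rewrite !gt_eqF.
by rewrite mulrC ler_wpM2l ?(ltW t0)// ler_pdivlMr// mulrC ltW.
Qed.

(** This is [hbar_dominated] summed over [x], both marginals having mass 1. The first sum pairs
    [margX Q] with the quantile of [P], the form in which the components of a mixture recombine. *)
Lemma Hs_eps_dominated (t e e' : R) :
  0 < t -> 0 < e < 1 -> 0 < e' ->
  (Hs_eps Q e' n <=
   \esum_(x in [set: n.-tuple X]) ((margX Q x)%:E * hbar P e x)
   + (- log2 e + 2 * e * t / (e' * c))%:E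
   + e'^-1%:E * \esum_(z in [set z | (t <= log2 (1 / condXY Q z.1 z.2))%R])
      (Q n z * log2 (1 / condXY Q z.1 z.2))%:E)%E.
Proof.
move=> t0 /[dup] e01 /andP[e0 e1] e'0.
apply: le_trans (le_esum (fun x _ => hbar_dominated x t e e' t0 e01 e'0)) _.
have l0 : 0 <= - log2 e by rewrite oppr_ge0 log2_le0// ltW.
have k0 : 0 <= 2 * e * t / (e' * c) by rewrite divr_ge0 ?mulr_ge0 ?ltW.
have f0 x y : (0 <= (Q n (x, y) * log2 (1 / condXY Q x y))%:E)%E.
  by rewrite lee_fin mulr_ge0// information_ge0.
have q0 (x : n.-tuple X) : (0 <= (margX Q x)%:E)%E.
  by rewrite lee_fin ltW// margX_gt0.
have p0 (x : n.-tuple X) : (0 <= (margX P x)%:E)%E.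
  by rewrite lee_fin ltW// margX_gt0.
have h0 (x : n.-tuple X) : (0 <= hbar P e x)%E by rewrite hbar_ge0.
rewrite !esumD; try by move=> x _;
  rewrite ?adde_ge0 ?mule_ge0 ?lee_fin ?invr_ge0 ?(ltW e'0)// ?esum_ge0// -lee_fin.
rewrite !esumZl//; last 2 first.
- by rewrite invr_ge0 ltW.
- by move=> x; exact: esum_ge0.
rewrite !esum_margX// !mule1 EFinD addeA leeD2l//.
rewrite lee_wpmul2l ?lee_fin ?invr_ge0 ?(ltW e'0)//.
rewrite (esum_prod (fun x y => (Q n (x, y) * log2 (1 / condXY Q x y))%:E)
  [set z | (t <= log2 (1 / condXY Q z.1 z.2))%R])//.
by apply: le_esum => -[].
Qed.

End Domination.

(** * The mixture as a source, and its quantile entropy as a weighted sum *)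

Section Mixture.
Context {R : realType} {X Y : countType}.
Variables (P1 P2 : source R X Y) (a1 a2 : R).
Hypotheses (srcP1 : is_source P1) (srcP2 : is_source P2).
Hypotheses (a1_gt0 : 0 < a1) (a2_gt0 : 0 < a2) (a12 : a1 + a2 = 1).

Let mixE n (T : choiceType) (f : T -> n.-tuple X * n.-tuple Y) : (0 < n)%N ->
  \esum_(t in [set: T]) (mixture a1 a2 P1 P2 (f t))%:E =
  (a1%:E * (\esum_(t in [set: T]) (P1 n (f t))%:E) +
   a2%:E * (\esum_(t in [set: T]) (P2 n (f t))%:E))%E.
Proof.
move=> n0; have P1_ge0 z : (0 <= (P1 n z)%:E)%E by rewrite lee_fin source_ge0.
have P2_ge0 z : (0 <= (P2 n z)%:E)%E by rewrite lee_fin source_ge0.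
rewrite -!esumZl ?(ltW a1_gt0) ?(ltW a2_gt0)// -esumD//.
- by move=> t _; rewrite mule_ge0// lee_fin ltW.
- by move=> t _; rewrite mule_ge0// lee_fin ltW.
Qed.

Lemma margX_mixture n (x : n.-tuple X) : (0 < n)%N ->
  margX (mixture a1 a2 P1 P2) x = a1 * margX P1 x + a2 * margX P2 x.
Proof.
by move=> n0; rewrite {1}/margX mixE// -(margXE srcP1)// -(margXE srcP2).
Qed.

Lemma margY_mixture n (y : n.-tuple Y) : (0 < n)%N ->
  margY (mixture a1 a2 P1 P2) y = a1 * margY P1 y + a2 * margY P2 y.
Proof.
by move=> n0; rewrite {1}/margY mixE// -(margYE srcP1)// -(margYE srcP2).
Qed.

Lemma is_source_mixture : is_source (mixture a1 a2 P1 P2).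
Proof.
move=> n n0; split.
- by move=> z; rewrite addr_ge0// mulr_ge0 ?(ltW a1_gt0) ?(ltW a2_gt0) ?source_ge0.
- rewrite (mixE _ _ id)//.
  by rewrite (esum_source srcP1)// (esum_source srcP2)// !mule1 -EFinD a12.
- by move=> x; rewrite margX_mixture// addr_gt0// mulr_gt0// margX_gt0.
- by move=> y; rewrite margY_mixture// addr_gt0// mulr_gt0// margY_gt0.
Qed.

(** The quantile stays that of the mixture; only the weight [margX] splits, linearly. The bound
    [eps < 1] makes [hbar] nonnegative, as the sum rules require. *)
Lemma Hs_eps_mixture (eps : R) n : (0 < n)%N -> eps < 1 ->
  Hs_eps (mixture a1 a2 P1 P2) eps n =
  (a1%:E * (\esum_(x in [set: n.-tuple X])
     ((margX P1 x)%:E * hbar (mixture a1 a2 P1 P2) eps x)) +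
   a2%:E * (\esum_(x in [set: n.-tuple X])
     ((margX P2 x)%:E * hbar (mixture a1 a2 P1 P2) eps x)))%E.
Proof.
move=> n0 eps1.
have h0 (x : n.-tuple X) : (0 <= hbar (mixture a1 a2 P1 P2) eps x)%E.
  by rewrite hbar_ge0//; exact: is_source_mixture.
have q1 (x : n.-tuple X) : (0 <= (margX P1 x)%:E)%E.
  by rewrite lee_fin ltW// margX_gt0.
have q2 (x : n.-tuple X) : (0 <= (margX P2 x)%:E)%E.
  by rewrite lee_fin ltW// margX_gt0.
have a1E : (0 <= a1%:E)%E by rewrite lee_fin ltW.
have a2E : (0 <= a2%:E)%E by rewrite lee_fin ltW.
rewrite -!esumZl ?(ltW a1_gt0) ?(ltW a2_gt0)//; last 2 first.
- by move=> x; rewrite mule_ge0.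
- by move=> x; rewrite mule_ge0.
rewrite -esumD; last 2 first.
- by move=> x _; rewrite !mule_ge0.
- by move=> x _; rewrite !mule_ge0.
apply: eq_esum => x _.
by rewrite margX_mixture// EFinD !EFinM ge0_muleDl ?mule_ge0// !muleA.
Qed.

End Mixture.

(** * Limits in [n] and in [eps] *)

Section Asymptotics.
Context {R : realType} {X Y : countType}.

(** [Zfun] is the information density divided by [n], so multiplying its truncated mean by [n] turns
    the cut-off [u] into [n * u] and the bound [eta] into [n * eta], with the same [u] for all
    [n]. *)
Lemma unif_integrable_tail (Q : source R X Y) (eta : R) :
  is_source Q -> unif_integrable Q -> 0 < eta ->
  exists2 u : R, 0 < u & forall n, (0 < n)%N ->
    (\esum_(z in [set z | (n%:R * u <= log2 (1 / @condXY _ _ _ Q n z.1 z.2))%R])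
      (Q n z * log2 (1 / condXY Q z.1 z.2))%:E <= (n%:R * eta)%:E)%E.
Proof.
move=> srcQ UI eta0.
have [M [_ HM]] : \forall u \near +oo, (ereal_sup [set
     (\esum_(z in [set z : R | (u <= `|z|)%R]) (PZ Q n z * (`|z|)%:E))%E
     | n in [set n : nat | (0 < n)%N]] < eta%:E)%E.
  exact: (UI _ (@nbhs_open_ereal_lt _ 0 (fun=> eta) eta0)).
(* Strictly above [M], as the eventual bound requires, and positive. *)
pose u := Num.max M 0 + 1.
have u0 : 0 < u by rewrite ltr_wpDl// le_max lexx orbT.
exists u => // n n0.
have {}HM : (\esum_(z in [set z : R | (u <= `|z|)%R]) (PZ Q n z * (`|z|)%:E)
    <= eta%:E)%E.
  have Mu : M < u by rewrite ltr_pwDr// le_max lexx.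
  apply: le_trans (ltW (HM _ Mu)).
  by apply: ereal_sup_ubound; exists n.
have nr0 : 0 < n%:R :> R by rewrite ltr0n.
have PE z : (0 <= (Q n z)%:E)%E by rewrite lee_fin source_ge0.
have fibers : \esum_(z in [set z : R | (u <= `|z|)%R]) (PZ Q n z * (`|z|)%:E)%E =
    \esum_(z in [set z | (u <= `|Zfun Q z|)%R]) ((`|Zfun Q z|)%:E * (Q n z)%:E)%E.
  rewrite -(esum_fibers (@Zfun _ _ _ Q n) [set r | (u <= `|r|)%R]); last first.
    by move=> z; rewrite mule_ge0.
  apply: eq_esum => r _; rewrite /PZ muleC -esumZl//.
  by apply: eq_esum => z /= ->.
rewrite EFinM; apply: le_trans (lee_wpmul2l _ HM); last by rewrite lee_fin ltW.
rewrite fibers -esumZl ?(ltW nr0)//; last by move=> z; rewrite mule_ge0.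
have ZE z : `|Zfun Q z| = n%:R^-1 * log2 (1 / @condXY _ _ _ Q n z.1 z.2).
  by rewrite ger0_norm// mulr_ge0 ?invr_ge0 ?(ltW nr0)// information_ge0.
rewrite [X in (esum X _ <= _)%E](_ : _ = [set z | (u <= `|@Zfun _ _ _ Q n z|)%R]); last first.
  by apply/seteqP; split => z /=; rewrite ZE ler_pdivlMl.
apply: le_esum => z _; rewrite -!EFinM lee_fin ZE le_eqVlt; apply/orP; left.
by apply/eqP; field; rewrite gt_eqF.
Qed.

(** With [t = n * u], three errors receive [eta / 3] each after division by [n]. The order of choice
    is [u] from [e'] and [eta], then [e], then [N] depending on [e]. *)
Lemma Hs_eps_dominated_asymptotic (P Q : source R X Y) (c e' eta : R) :
  is_source P -> is_source Q -> unif_integrable Q -> 0 < c ->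
  (forall n, (0 < n)%N -> forall z, c * Q n z <= P n z) -> 0 < e' -> 0 < eta ->
  exists2 e0 : R, 0 < e0 < 1 & forall e, 0 < e <= e0 ->
    exists N, forall n, (0 < n)%N -> (N <= n)%N ->
      (n%:R^-1%:E * Hs_eps Q e' n <= n%:R^-1%:E *
        (\esum_(x in [set: n.-tuple X]) ((margX Q x)%:E * hbar P e x)) + eta%:E)%E.
Proof.
move=> srcP srcQ UI c0 QP e'0 eta0.
(* The factor [e'] cancels the [e'^-1] in front of the truncated mean. *)
have k0 : 0 < e' * (eta / 3) by rewrite mulr_gt0// divr_gt0.
have [u u0 tail] := unif_integrable_tail _ _ srcQ UI k0.
(* The bound [2^-1] keeps [e0] below 1; the other makes [2 * e * u / (e' * c)] at most [eta / 3]. *)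
pose e0 := Num.min (2^-1) (eta / 3 * (e' * c) / (2 * u)).
exists e0.
  apply/andP; split; last by rewrite gt_min; apply/orP; left; lra.
  by rewrite lt_min invr_gt0 ltr0n/= divr_gt0 ?mulr_gt0 ?invr_gt0 ?ltr0n.
move=> e /andP[epos]; rewrite le_min => /andP[e2 eu].
have e1 : e < 1 by lra.
have l0 : 0 <= - log2 e by rewrite oppr_ge0 log2_le0// ltW.
(* From this index on, [- log2 e / n] is at most [eta / 3]. *)
exists (Num.bound (- log2 e / (eta / 3))) => n n0 Nn.
have nr0 : 0 < n%:R :> R by rewrite ltr0n.
have ni0 : (0 <= n%:R^-1%:E :> \bar R)%E by rewrite lee_fin invr_ge0 ltW.
have nl : - log2 e / n%:R <= eta / 3.
  rewrite ler_pdivrMr// mulrC -ler_pdivrMr ?divr_gt0//.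
  have x0 : 0 <= - log2 e / (eta / 3) by rewrite !divr_ge0 ?(ltW eta0).
  by apply: le_trans (ltW (archi_boundP x0)) _; rewrite ler_nat.
have {}eu : 2 * e * u / (e' * c) <= eta / 3.
  rewrite ler_pdivrMr ?mulr_gt0//.
  by move: eu; rewrite ler_pdivlMr ?mulr_gt0//; lra.
have e01 : 0 < e < 1 by rewrite epos.
have nu0 : 0 < n%:R * u by rewrite mulr_gt0.
have main := Hs_eps_dominated srcP srcQ n0 c0 (QP n n0) _ _ _ nu0 e01 e'0.
apply: le_trans (lee_wpmul2l ni0 main) _.
have S0 : (0 <= \esum_(x in [set: n.-tuple X]) ((margX Q x)%:E * hbar P e x))%E.
  by apply: esum_ge0 => x _; rewrite mule_ge0 ?hbar_ge0// lee_fin ltW// margX_gt0.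
set S := esum _ _ in S0 *.
set T := esum _ _.
have TE : (T <= (n%:R * (e' * (eta / 3)))%:E)%E by exact: tail.
have {}TE : (e'^-1%:E * T <= (n%:R * (eta / 3))%:E)%E.
  apply: le_trans (lee_wpmul2l _ TE) _; first by rewrite lee_fin invr_ge0 ltW.
  rewrite -EFinM lee_fin le_eqVlt; apply/orP; left; apply/eqP; field.
  by rewrite gt_eqF.
apply: le_trans (lee_wpmul2l ni0 (leeD2l _ TE)) _.
rewrite -addeA -EFinD ge0_muleDr//; last first.
  rewrite lee_fin !addr_ge0// ?mulr_ge0 ?invr_ge0 ?mulr_ge0 ?(ltW e'0) ?(ltW c0)
    ?(ltW nr0) ?(ltW epos) ?(ltW u0) ?(ltW eta0)//.
rewrite leeD2l// -EFinM lee_fin.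
have -> : n%:R^-1 * (- log2 e + 2 * e * (n%:R * u) / (e' * c) + n%:R * (eta / 3)) =
  - log2 e / n%:R + 2 * e * u / (e' * c) + eta / 3.
  by field; rewrite !gt_eqF.
by lra.
Qed.

(** Intersecting any [V] in the filter with [maxn N 1 <= n] keeps it in the filter. The 1 discards
    [n = 0], where [is_source] imposes nothing. *)
Lemma le_limn_esup (f g : nat -> \bar R) (d : R) (N : nat) :
  (forall n, (0 < n)%N -> (N <= n)%N -> (f n <= g n + d%:E)%E) ->
  (limn_esup f <= limn_esup g + d%:E)%E.
Proof.
move=> fg; rewrite -leeBlDr//; apply/ereal_infP => _ [V V_oo <-].
rewrite leeBlDr//.
apply: (@le_trans _ _ (ereal_sup [set f x | x in V `&` [set n | (maxn N 1 <= n)%N]])).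
  apply: ereal_inf_lbound; exists (V `&` [set n | (maxn N 1 <= n)%N]) => //.
  by apply: filterI => //; exists (maxn N 1).
apply/ereal_supP => _ [n [Vn]] + <-; rewrite /= geq_max => /andP[Nn n0].
apply: le_trans (fg n n0 Nn) _; rewrite leeD2r//.
by apply: ereal_sup_ubound; exists n.
Qed.

(** A nonincreasing function tends at [0^'+] to its supremum. Comparing two such limits thus amounts
    to finding, for each parameter on one side, a suitable one on the other. *)
Lemma lim_at_right0_antitone (f : R -> \bar R) :
  (forall e e', e <= e' -> (f e' <= f e)%E) ->
  lim (f @ 0^'+) = ereal_sup (f @` [set e | 0 < e < 1]).
Proof.
move=> anti; apply: cvg_lim => //.
have -> : [set e : R | 0 < e < 1] = [set` Interval (BRight 0) (BLeft 1)].
  by apply/seteqP; split => e /=; rewrite in_itv.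
by apply: nonincreasing_at_right_cvge => [|e e' _ _ /anti//]; rewrite bnd_simp.
Qed.

End Asymptotics.

Theorem theorem10 (R : realType) (X Y : countType) (P1 P2 : source R X Y)
  (a1 a2 : R) :
  is_source P1 -> is_source P2 ->
  unif_integrable P1 -> unif_integrable P2 ->
  0 < a1 -> 0 < a2 -> a1 + a2 = 1 ->
  (Hs (mixture a1 a2 P1 P2) >=
   lim ((fun eps : R =>
          limn_esup (fun n =>
            ((a1 / n%:R)%:E * Hs_eps P1 eps n
             + (a2 / n%:R)%:E * Hs_eps P2 eps n)%E)) @ 0^'+))%E.
Proof.
move=> srcP1 srcP2 UI1 UI2 a10 a20 a12.
have srcP := is_source_mixture _ _ _ _ srcP1 srcP2 a10 a20 a12.
set P := mixture a1 a2 P1 P2 in srcP *.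
have coef0 (a : R) n : 0 < a -> (0 <= (a / n%:R)%:E)%E.
  by move=> a0; rewrite lee_fin divr_ge0 ?(ltW a0).
rewrite /Hs !lim_at_right0_antitone; last 2 first.
- move=> e e' ee'; rewrite -[leRHS]adde0; apply: (@le_limn_esup _ _ _ _ 0) => n n0 _.
  by rewrite adde0 lee_wpmul2l ?le_Hs_eps// lee_fin invr_ge0.
- move=> e e' ee'; rewrite -[leRHS]adde0; apply: (@le_limn_esup _ _ _ _ 0) => n n0 _.
  by rewrite adde0 leeD// lee_wpmul2l ?coef0// le_Hs_eps.
(* With [e'] fixed for the components, one [e] for the mixture has to be found, up to an error
   [eta]. *)
apply/ereal_supP => _ [e' /= /andP[e'0 e'1] <-].
apply/lee_addgt0Pr => eta eta0.
have dom1 n : (0 < n)%N -> forall z, a1 * P1 n z <= P n z.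
  by move=> n0 z; rewrite lerDl mulr_ge0 ?(ltW a20) ?source_ge0.
have dom2 n : (0 < n)%N -> forall z, a2 * P2 n z <= P n z.
  by move=> n0 z; rewrite lerDr mulr_ge0 ?(ltW a10) ?source_ge0.
have [e1 /andP[e10 e11] H1] :=
  Hs_eps_dominated_asymptotic _ _ _ _ _ srcP srcP1 UI1 a10 dom1 e'0 eta0.
have [e2 /andP[e20 e21] H2] :=
  Hs_eps_dominated_asymptotic _ _ _ _ _ srcP srcP2 UI2 a20 dom2 e'0 eta0.
(* The quantile of the mixture must be taken at the same [e] for both components. *)
pose e := Num.min e1 e2.
have e0 : 0 < e by rewrite lt_min e10.
have elt1 : e < 1 by rewrite gt_min e11.
have [|N1 {}H1] := H1 e; first by rewrite e0 ge_min lexx.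
have [|N2 {}H2] := H2 e; first by rewrite e0 ge_min lexx orbT.
apply: (@le_trans _ _ (limn_esup (fun n => (n%:R^-1%:E * Hs_eps P e n)%E) + eta%:E)%E).
  apply: (@le_limn_esup _ _ _ _ (maxn N1 N2)) => n n0.
  rewrite geq_max => /andP[/(H1 n n0) {}H1 /(H2 n n0) {}H2].
  rewrite !EFinM -!muleA.
  have a1E : (0 <= a1%:E)%E by rewrite lee_fin ltW.
  have a2E : (0 <= a2%:E)%E by rewrite lee_fin ltW.
  (* The errors add up to [a1 * eta + a2 * eta = eta], and the main terms recombine by
     [Hs_eps_mixture]. *)
  apply: le_trans (leeD (lee_wpmul2l a1E H1) (lee_wpmul2l a2E H2)) _.
  have ni0 : (0 <= n%:R^-1%:E :> \bar R)%E by rewrite lee_fin invr_ge0.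
  have S0 (Q : source R X Y) : is_source Q ->
      (0 <= \esum_(x in [set: n.-tuple X]) ((margX Q x)%:E * hbar P e x))%E.
    move=> srcQ; apply: esum_ge0 => x _.
    by rewrite mule_ge0 ?(hbar_ge0 srcP)// lee_fin ltW// (margX_gt0 srcQ).
  have S10 := S0 _ srcP1; have S20 := S0 _ srcP2.
  have etaE : (0 <= eta%:E)%E by rewrite lee_fin ltW.
  rewrite (Hs_eps_mixture _ _ _ _ srcP1 srcP2)// -/P.
  rewrite !ge0_muleDr ?mule_ge0//.
  rewrite addeACA -!EFinM -EFinD -mulrDl a12 mul1r.
  by rewrite !muleA (muleC a1%:E) (muleC a2%:E).
rewrite leeD2r//; apply: ereal_sup_ubound; exists e => //=.
by rewrite e0.
Qed.
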